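(* For every finitely generated Abelian group $A$, the wreath product $A \wr \mathbb{Z}$ possesses the RP property.
   Context: Wreath product: for a group $A$, $A\wr\mathbb{Z} := \left(\bigoplus_{i\in\mathbb{Z}}A_i\right)\rtimes\mathbb{Z}$, where each $A_i$ is a copy of $A$ and $n\in\mathbb{Z}$ acts on $\bigoplus_{i\in\mathbb{Z}} A_i$ by the shift taking $A_i$ identically onto $A_{n+i}$. Twisted conjugacy: let $G$ be a countable discrete group and $\phi$ an automorphism of $G$. Elements $x,x'\in G$ are $\phi$-conjugate if there is $g\in G$ with $x'=g\,x\,\phi(g^{-1})$. This is an equivalence relation; its classes are the $\phi$-conjugacy classes (Reidemeister classes), and the Reidemeister number $R(\phi)$ is the number of these classes (possibly infinite). RP property: a group $G$ has the RP property if for every automorphism $\phi$ of $G$ with $R(\phi)<\infty$ and every $\phi$-conjugacy class $C\subset G$ with characteristic function $f$, there exist a finite group $K$, an automorphism $\phi_K$ of $K$ and an epimorphism $F\colon G\to K$ such that $F\circ\phi=\phi_K\circ F$ and $f=f_K\circ F$, where $f_K$ is the characteristic function of some subset of $K$. *)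

(* Defs.v *)
(* Groups, possibly infinite, are [groupType]s in multiplicative notation. *)
From HB Require Import structures.
From mathcomp Require Import all_boot all_order all_algebra fingroup.
From mathcomp Require Import finmap.
From mathcomp Require Import boolp classical_sets cardinality.

Set Implicit Arguments.
Unset Strict Implicit.
Unset Printing Implicit Defensive.

Import GRing.Theory.

Local Open Scope group_scope.

(* Some finite subset lies in no proper subgroup. *)
Definition finitely_generated (G : groupType) : Prop :=
  exists s : seq G, forall H : set G,
    H 1 -> (forall x y, H x -> H y -> H (x / y)) ->
    (forall x, x \in s -> H x) -> forall x, H x.

Definition dsum (A : groupType) : Type := {fsfun int -> A with 1}.

HB.instance Definition _ (A : groupType) := Choice.on (dsum A).

Section DirectSum.
Variable A : groupType.
Implicit Types f g h : dsum A.

Definition dsum_one : dsum A := [fsfun with 1].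

Definition dsum_mul f g : dsum A :=
  [fsfun i in (finsupp f `|` finsupp g)%fset => f i * g i].

Definition dsum_inv f : dsum A := [fsfun i in finsupp f => (f i)^-1].

Lemma dsum_oneE i : dsum_one i = 1.
Proof. by rewrite fsfun0E. Qed.

Lemma dsum_mulE f g i : dsum_mul f g i = f i * g i.
Proof.
rewrite fsfunE in_fsetU; case: finsuppP => [Nf|//]; case: finsuppP => //= Ng.
by rewrite mulg1.
Qed.

Lemma dsum_invE f i : dsum_inv f i = (f i)^-1.
Proof. by rewrite fsfunE; case: finsuppP => // _; rewrite invg1. Qed.

Lemma dsum_mulA : associative dsum_mul.
Proof. by move=> f g h; apply/fsfunP => i; rewrite !dsum_mulE mulgA. Qed.

Lemma dsum_mul1g : left_id dsum_one dsum_mul.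
Proof. by move=> f; apply/fsfunP => i; rewrite dsum_mulE dsum_oneE mul1g. Qed.

Lemma dsum_mulg1 : right_id dsum_one dsum_mul.
Proof. by move=> f; apply/fsfunP => i; rewrite dsum_mulE dsum_oneE mulg1. Qed.

Lemma dsum_mulVg : left_inverse dsum_one dsum_inv dsum_mul.
Proof.
by move=> f; apply/fsfunP => i; rewrite dsum_mulE dsum_invE dsum_oneE mulVg.
Qed.

Lemma dsum_mulgV : right_inverse dsum_one dsum_inv dsum_mul.
Proof.
by move=> f; apply/fsfunP => i; rewrite dsum_mulE dsum_invE dsum_oneE mulgV.
Qed.

HB.instance Definition _ := isGroup.Build (dsum A)
  dsum_mulA dsum_mul1g dsum_mulg1 dsum_mulVg dsum_mulgV.

(* The action of n on the direct sum: the entry of f at j is moved to n + j. *)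
Definition dsum_shift (n : int) f : dsum A :=
  [fsfun i in [fset (n + j)%R | j in finsupp f]%fset => f (i - n)%R].

Lemma dsum_shiftE n f i : dsum_shift n f i = f (i - n)%R.
Proof.
rewrite fsfunE; case: ifPn => // /imfsetP Ni.
case: finsuppP => // fi; case: Ni; exists (i - n)%R => //.
by rewrite addrCA subrr addr0.
Qed.

Lemma dsum_shift0 f : dsum_shift 0 f = f.
Proof. by apply/fsfunP => i; rewrite dsum_shiftE subr0. Qed.

Lemma dsum_shiftD m n f :
  dsum_shift (m + n)%R f = dsum_shift m (dsum_shift n f).
Proof. by apply/fsfunP => i; rewrite !dsum_shiftE opprD addrA. Qed.

Lemma dsum_shiftM n f g :
  dsum_shift n (f * g) = dsum_shift n f * dsum_shift n g.
Proof.
apply/fsfunP => i; rewrite dsum_shiftE [LHS]dsum_mulE [RHS]dsum_mulE.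
by rewrite !dsum_shiftE.
Qed.

Lemma dsum_shift1 n : dsum_shift n 1 = 1.
Proof. by apply/fsfunP => i; rewrite dsum_shiftE !dsum_oneE. Qed.

End DirectSum.

(* A wr Z, with (f, m) standing for the product of f in the direct sum by the
   element m of Z. *)
Definition wreathZ (A : groupType) : Type := (dsum A * int)%type.

HB.instance Definition _ (A : groupType) := Choice.on (wreathZ A).

Section WreathZ.
Variable A : groupType.
Implicit Types u v w : wreathZ A.

Definition wreath_one : wreathZ A := (1, 0%R).

Definition wreath_mul u v : wreathZ A :=
  (u.1 * dsum_shift u.2 v.1, (u.2 + v.2)%R).

Definition wreath_inv u : wreathZ A :=
  (dsum_shift (- u.2)%R u.1^-1, (- u.2)%R).

Lemma wreath_mulA : associative wreath_mul.
Proof.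
move=> u v w; rewrite /wreath_mul /=.
by rewrite dsum_shiftM dsum_shiftD mulgA addrA.
Qed.

Lemma wreath_mul1g : left_id wreath_one wreath_mul.
Proof. by case=> f m; rewrite /wreath_mul /= dsum_shift0 mul1g add0r. Qed.

Lemma wreath_mulg1 : right_id wreath_one wreath_mul.
Proof. by case=> f m; rewrite /wreath_mul /= dsum_shift1 mulg1 addr0. Qed.

Lemma wreath_mulVg : left_inverse wreath_one wreath_inv wreath_mul.
Proof.
case=> f m; rewrite /wreath_mul /= -dsum_shiftM mulVg dsum_shift1.
by rewrite addNr.
Qed.

Lemma wreath_mulgV : right_inverse wreath_one wreath_inv wreath_mul.
Proof.
case=> f m; rewrite /wreath_mul /= -dsum_shiftD subrr dsum_shift0 mulgV.
by [].
Qed.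

HB.instance Definition _ := isGroup.Build (wreathZ A)
  wreath_mulA wreath_mul1g wreath_mulg1 wreath_mulVg wreath_mulgV.

End WreathZ.

Definition twisted_conj (G : groupType) (phi : G -> G) (x x' : G) : Prop :=
  exists g : G, x' = g * x * phi g^-1.

Definition reidemeister_classes (G : groupType) (phi : G -> G) : set (set G) :=
  [set C | exists x, C = [set y | twisted_conj phi x y]]%classic.

Definition char_fun (T : Type) (C : set T) (x : T) : nat := (x \in C).

(* The number of Reidemeister classes only enters through its finiteness. *)
Definition RP_property (G : groupType) : Prop :=
  forall phi : {multiplicative G -> G}, bijective phi ->
  finite_set (reidemeister_classes phi) ->
  forall C : set G, reidemeister_classes phi C ->
  exists (K : finGroupType) (phiK : {multiplicative K -> K})
         (F : {multiplicative G -> K}) (S : set K),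
    [/\ bijective phiK,
        (forall k : K, exists x : G, F x = k),
        F \o phi =1 phiK \o F
      & char_fun C =1 char_fun S \o F].

(* Main.v *)
(* Write B for the base group of A wr Z, t for the shift of B by 1, and let phi
   have finitely many twisted classes. Then phi preserves B and induces -1 on Z,
   so its restriction f to B satisfies f t = t^-1 f and commutes with
   w = t + t^-1. Hence f is Z[w]-linear, and so is each h |-> h - t^n (f h),
   whose image D_n determines the twisted classes inside the coset B x {n}.
   If r is the number of twisted classes, a pigeonhole argument on the finite
   module B / D_n shows that D_n contains, for every n, the submodule
   M = r! B + (w^(r + r!) - w^r) B. As M is defined by polynomials in w, it is
   stable under both t and f; it has finite index because B is finitely
   generated over Z[w] (by s and t s for s in a generating set of A) and w is
   integral modulo M. Finally the pairs (x, 2k) with x in M and k in a suitable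
   subgroup of Z form a normal phi-stable subgroup of finite index, and every
   twisted class is a union of its cosets. *)
Require Import Defs.
From HB Require Import structures.
From mathcomp Require Import all_boot all_order all_algebra fingroup.
From mathcomp Require Import finmap zify.
From mathcomp Require Import boolp classical_sets cardinality.

Set Implicit Arguments.
Unset Strict Implicit.
Unset Printing Implicit Defensive.

Import GRing.Theory.

(* A period of h is at most size l, hence divides (size l)`!. *)
Lemma pigeonhole_period (T : eqType) (l : seq T) (h : nat -> T) :
  (forall k, h k \in l) ->
  (forall m n j, h m = h n -> h (m + j)%N = h (n + j)%N) ->
  h (size l + (size l)`!)%N = h (size l).
Proof.
move=> hl hshift; set r := size l.
have [i [j [ltij lejr eq_h]]] :
    exists i j, [/\ (i < j)%N, (j <= r)%N & h i = h j].
  have : ~~ uniq (map h (iota 0 r.+1)).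
    apply/negP => /uniq_leq_size le_sz.
    have /le_sz : {subset map h (iota 0 r.+1) <= l} by move=> _ /mapP[k _ ->].
    by rewrite size_map size_iota ltnn.
  case/(uniqPn (h 0%N)) => i [j [ltij]].
  rewrite size_map size_iota ltnS => lejr.
  rewrite !(nth_map 0%N) ?size_iota ?nth_iota ?add0n //; try lia.
  by move=> eq_h; exists i, j.
have per k : h (i + k * (j - i))%N = h i.
  elim: k => [|k IHk]; first by rewrite mul0n addn0.
  by rewrite mulSn addnCA addnC (hshift _ _ _ IHk) subnKC // ltnW.
have /dvdnP[k ->] : (j - i %| r`!)%N by apply: dvdn_fact; lia.
have -> : (r + k * (j - i) = i + k * (j - i) + (r - i))%N by lia.
by rewrite (hshift _ _ _ (per k)); congr h; lia.
Qed.

(** * Finite quotients of groups, and subsets that factor through them *)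

Section Groups.
Local Open Scope group_scope.

Lemma multiplicative1 (G H : groupType) (f : {multiplicative G -> H}) : f 1 = 1.
Proof. by apply: (mulgI (f 1)); rewrite -gmulfM !mulg1. Qed.

Lemma multiplicativeV (G H : groupType) (f : {multiplicative G -> H}) x :
  f x^-1 = (f x)^-1.
Proof.
by apply: (mulgI (f x)); rewrite -gmulfM !mulgV multiplicative1.
Qed.

(** The carrier of [K] consists of coset representatives, [r x] being the first element of [l] in
    the coset of [x]; products are computed in [G] and reduced to their representative. *)
Lemma finite_quotient (G : groupType) (N : G -> Prop) (l : seq G) :
  N 1 -> (forall x y, N x -> N y -> N (x^-1 * y)) ->
  (forall x y, N x -> N (y^-1 * x * y)) ->
  (forall x, exists2 y, y \in l & N (y^-1 * x)) ->
  exists (K : finGroupType) (F : {multiplicative G -> K}),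
    (forall k, exists x, F x = k) /\ (forall x y, F x = F y <-> N (x^-1 * y)).
Proof.
move=> N1 NV NJ Nl.
have NVg x : N x -> N x^-1 by move=> /NV/(_ N1); rewrite mulg1.
have NM x y : N x -> N y -> N (x * y).
  by move=> /NVg/NV NxV /NxV; rewrite invgK.
pose r x := nth 1 l (find (fun y => `[< N (y^-1 * x) >]) l).
have rN x : N ((r x)^-1 * x).
  apply/asboolP; apply: (nth_find 1 (a := fun y => `[< N (y^-1 * x) >])).
  by have [y ly Ny] := Nl x; apply/hasP; exists y => //; apply/asboolP.
have r_eq x y : N (x^-1 * y) -> r x = r y.
  move=> Nxy; rewrite /r; congr nth; apply: eq_find => z.
  apply: asbool_equiv_eq; split=> Nz.
    by have := NM _ _ Nz Nxy; rewrite mulgA mulgK.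
  by have := NM _ _ Nz (NVg _ Nxy); rewrite invgM invgK mulgA mulgK.
have rP x y : r x = r y <-> N (x^-1 * y).
  split=> [eq_r|]; last exact: r_eq.
  have := NV _ _ (rN x) (rN y); rewrite eq_r.
  by rewrite invgM invgK mulgA mulgK.
have rr x : r (r x) = r x by apply/rP.
pose T := seq_sub [seq r x | x <- l].
have rT x : r x \in [seq r x | x <- l].
  by have [y ly Ny] := Nl x; rewrite -(r_eq _ _ Ny) map_f.
pose c x : T := SeqSub (rT x).
have cK (k : T) : r (ssval k) = ssval k.
  by case: k => _ /= /mapP[y _ ->].
have cP x y : c x = c y <-> N (x^-1 * y).
  by rewrite -rP; split=> [[]//|eq_r]; apply: val_inj.
have cv (k : T) : c (ssval k) = k by apply: val_inj; rewrite /= cK.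
have cr x : c (r x) = c x by apply/cP.
pose mul (k1 k2 : T) : T := c (ssval k1 * ssval k2).
have cM x y : c (x * y) = mul (c x) (c y).
  apply/esym/cP => /=; rewrite invgM -mulgA [_^-1 * (x * y)]mulgA.
  (* Normality moves the factor of [x] lying in [N] across [y]. *)
  have -> : (r y)^-1 * ((r x)^-1 * x * y) =
            ((r y)^-1 * y) * (y^-1 * ((r x)^-1 * x) * y).
    by rewrite !mulgA mulgK.
  by apply: (NM _ _ (rN y)); apply: NJ.
pose inv (k : T) : T := c (ssval k)^-1.
have mulA : associative mul.
  move=> k1 k2 k3; rewrite -[k1]cv -[k2]cv -[k3]cv -!cM.
  by rewrite mulgA.
have mul1 : left_id (c 1) mul by move=> k; rewrite -[k]cv -cM mul1g.
have mulV : left_inverse (c 1) inv mul.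
  by move=> k; rewrite -{2}[k]cv /inv -cM mulVg.
pose K : finGroupType := HB.pack T (Finite_isGroup.Build T mulA mul1 mulV).
pose F : {multiplicative G -> K} :=
  HB.pack (c : G -> K) (isMultiplicative.Build G K c cM).
exists K, F; split=> [k|x y]; last exact: cP.
by exists (ssval (k : T)); apply: cv.
Qed.

(** A union of cosets of [N] is the preimage of its image in the quotient. The map induced by [phi]
    is onto, hence bijective because the quotient is finite. *)
Lemma RP_of_normal (G : groupType) (phi : {multiplicative G -> G})
    (N : G -> Prop) (l : seq G) (C : set G) :
  bijective phi ->
  N 1 -> (forall x y, N x -> N y -> N (x^-1 * y)) ->
  (forall x y, N x -> N (y^-1 * x * y)) ->
  (forall x, exists2 y, y \in l & N (y^-1 * x)) ->
  (forall x, N x -> N (phi x)) ->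
  (forall x y, C x -> N y -> C (x * y)) ->
  exists (K : finGroupType) (phiK : {multiplicative K -> K})
         (F : {multiplicative G -> K}) (S : set K),
    [/\ bijective phiK,
        (forall k : K, exists x : G, F x = k),
        F \o phi =1 phiK \o F
      & char_fun C =1 char_fun S \o F].
Proof.
move=> bij_phi N1 NV NJ Nl Nphi NC.
have [K [F [Fsurj FP]]] := finite_quotient N1 NV NJ Nl.
have Fphi x y : F x = F y -> F (phi x) = F (phi y).
  by move/FP=> Nxy; apply/FP; rewrite -multiplicativeV -gmulfM; apply: Nphi.
pose s k := projT1 (cid (Fsurj k)).
have sK k : F (s k) = k by rewrite /s; case: cid.
pose psi k := F (phi (s k)).
have psiF x : psi (F x) = F (phi x) by apply: Fphi.
have psiM : {morph psi : k1 k2 / k1 * k2}.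
  by move=> k1 k2; rewrite -(sK k1) -(sK k2) -gmulfM !psiF !gmulfM.
pose phiK : {multiplicative K -> K} :=
  HB.pack psi (isMultiplicative.Build K K psi psiM).
exists K, phiK, F, [set k | exists2 x, C x & F x = k]%classic; split=> //.
- have [phi' _ phi'K] := bij_phi.
  pose psi' k := F (phi' (s k)).
  have psi'K : cancel psi' psi by move=> k; rewrite psiF phi'K sK.
  rewrite /=; exact: (bij_can_bij (injF_bij (can_inj psi'K)) psi'K).
- by move=> x /=; rewrite psiF.
- move=> x; rewrite /char_fun /=; congr (nat_of_bool _).
  apply/idP/idP; rewrite !inE /=; first by exists x.
  by case=> y Cy /FP /(NC _ _ Cy); rewrite mulVKg.
Qed.

End Groups.

(** * Subgroups of additive groups and finiteness modulo a subgroup *)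

Section ShiftModule.
Local Open Scope ring_scope.

Definition sub_closed (V : zmodType) (H : V -> Prop) :=
  H 0 /\ forall x y, H x -> H y -> H (x - y).

Section SubClosed.
Variables (V : zmodType) (H : V -> Prop) (subH : sub_closed H).

Lemma sub_closedN x : H x -> H (- x).
Proof. by case: subH => H0 HB /(HB _ _ H0); rewrite sub0r. Qed.

Lemma sub_closedD x y : H x -> H y -> H (x + y).
Proof. by case: subH => _ HB Hx /sub_closedN/(HB _ _ Hx); rewrite opprK. Qed.

Lemma sub_closedMn x n : H x -> H (x *+ n).
Proof.
move=> Hx; elim: n => [|n IHn]; first by case: subH.
by rewrite mulrS; apply: sub_closedD.
Qed.

End SubClosed.

(** [H] is the subgroup generated by [M] and [s]. It is finite modulo [M], since each new generator
    contributes only its multiples below [e]. The last clause is an induction principle for [H]. *)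
Lemma finite_mod_exponent (V : zmodType) (M : V -> Prop) (e : nat) (s : seq V) :
  sub_closed M -> (0 < e)%N -> (forall x, M (x *+ e)) ->
  exists l : seq V, let H x := exists2 y, y \in l & M (x - y) in
  [/\ sub_closed H, forall x, x \in s -> H x, forall x, M x -> H x &
    forall H' : V -> Prop, sub_closed H' -> (forall x, x \in s -> H' x) ->
      (forall x, M x -> H' x) -> forall x, H x -> H' x].
Proof.
move=> subM e_gt0 Me; have [M0 MB] := subM.
elim: s => [|a s [l [subH Hs MH minH]]].
  exists [:: 0]; split=> //.
  - split; first by exists 0; rewrite ?inE ?subr0.
    move=> x y [_ /[!inE]/eqP-> Mx] [_ /[!inE]/eqP-> My].
    by exists 0; rewrite ?inE // subr0; move: Mx My; rewrite !subr0; apply: MB.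
  - by move=> x Mx; exists 0; rewrite ?inE ?subr0.
  - by move=> H' _ _ MH' x [_ /[!inE]/eqP->]; rewrite subr0; apply: MH'.
have [H0 HB] := subH.
set H := fun x => exists2 y, y \in l & M (x - y) in subH H0 HB Hs MH minH.
pose l' := [seq a *+ i + y | i <- iota 0 e, y <- l].
pose H2 x := exists2 y, y \in l' & M (x - y).
have H2P x : H2 x <-> exists i, H (x - a *+ i).
  split=> [[_ /allpairsP[[i y] /= [_ ly ->]]]|[i [y ly Mxy]]].
    by rewrite opprD addrA => Mxy; exists i, y.
  exists (a *+ (i %% e) + y).
    by apply/allpairsP; exists (i %% e, y)%N; rewrite /= mem_iota ltn_mod.
  have -> : x - (a *+ (i %% e) + y) = (x - a *+ i - y) + a *+ (i %/ e) *+ e.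
    rewrite {2}(divn_eq i e) mulrnDr -mulrnA !opprD.
    by rewrite [RHS]addrC !addrA [_ + x]addrC addrK.
  by apply: sub_closedD.
(* Multipliers are natural numbers, so [- i] is replaced by [i * e.-1], which is congruent to it
   modulo [e]. *)
have aN i : a *+ (i * e.-1) = a *+ i *+ e - a *+ i.
  by rewrite -mulrnA -{2}(prednK e_gt0) mulnS mulrnDr addrAC subrr add0r.
exists l'; split=> //.
- split; first by apply/H2P; exists 0%N; rewrite subr0.
  move=> x y /H2P[i Hx] /H2P[j Hy]; apply/H2P; exists (i + j * e.-1)%N.
  have -> : x - y - a *+ (i + j * e.-1) =
            (x - a *+ i) - (y - a *+ j) - a *+ j *+ e.
    rewrite mulrnDr aN !opprD !opprK !addrA.
    rewrite [x - y - _]addrAC -!addrA; congr (_ + (_ + (_ + _))).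
    by rewrite addrC.
  apply: (HB); first exact: HB.
  by apply: MH; apply: Me.
- move=> x; rewrite inE => /predU1P[->|sx]; apply/H2P.
    by exists 1%N; rewrite mulr1n subrr.
  by exists 0%N; rewrite subr0; apply: Hs.
- by move=> x Mx; apply/H2P; exists 0%N; rewrite subr0; apply: MH.
- move=> H' subH' H's MH' x /H2P[i Hx].
  rewrite -(subrK (a *+ i) x); apply: sub_closedD => //.
    by apply: minH => // y sy; apply: H's; rewrite inE sy orbT.
  by apply: sub_closedMn => //; apply: H's; rewrite inE eqxx.
Qed.

(** * The operator w and the submodule M *)

Section Shift.
Variables (V : zmodType) (t : int -> {additive V -> V}).
Hypotheses (t0 : forall x, t 0 x = x)
           (tD : forall m n x, t (m + n) x = t m (t n x)).

(* The operator w of the header. *)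
Definition lap x : V := t 1 x + t (-1) x.

Lemma lapB x y : lap (x - y) = lap x - lap y.
Proof. by rewrite /lap !raddfB opprD addrACA. Qed.

HB.instance Definition _ := GRing.isZmodMorphism.Build V V lap lapB.

Lemma iter_lapB k x y : iter k lap (x - y) = iter k lap x - iter k lap y.
Proof. by elim: k => //= k ->; rewrite lapB. Qed.

Lemma iter_lap0 k : iter k lap 0 = 0.
Proof. by elim: k => //= k ->; rewrite raddf0. Qed.

Lemma iter_lap_comm (g : {additive V -> V}) k x :
  (forall x, g (lap x) = lap (g x)) -> g (iter k lap x) = iter k lap (g x).
Proof. by move=> gl; elim: k => //= k <-. Qed.

Lemma t_lap n x : t n (lap x) = lap (t n x).
Proof. by rewrite /lap raddfD -!tD ![(n + _)%R]addrC. Qed.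

(** The submodule e V + (w^b - w^a) V; the M of the header has e = r!, a = r and b = r + r!. *)
Definition lap_sub (e a b : nat) (x : V) :=
  exists y z, x = y *+ e + (iter b lap z - iter a lap z).

Section LapSub.
Variables e a b : nat.
Local Notation M := (lap_sub e a b).

Lemma lap_sub_closed : sub_closed M.
Proof.
split; first by exists 0, 0; rewrite mul0rn !iter_lap0 subr0 addr0.
move=> _ _ [y [z ->]] [y' [z' ->]]; exists (y - y'), (z - z').
rewrite mulrnBl !iter_lapB !opprD opprK addrACA; congr (_ + _).
by rewrite addrACA.
Qed.

Lemma lap_sub_morph (g : {additive V -> V}) x :
  (forall x, g (lap x) = lap (g x)) -> M x -> M (g x).
Proof.
move=> gl [y [z ->]]; exists (g y), (g z).
by rewrite raddfD raddfB raddfMn /= !(iter_lap_comm _ _ gl).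
Qed.

Lemma lap_sub_shift n x : M x -> M (t n x).
Proof. by apply: (lap_sub_morph (g := t n)) => y; apply: t_lap. Qed.

Lemma lap_sub_min (D : V -> Prop) : sub_closed D ->
  (forall x, D (x *+ e)) -> (forall x, D (iter b lap x - iter a lap x)) ->
  forall x, M x -> D x.
Proof. by move=> subD De Dl _ [y [z ->]]; apply: sub_closedD. Qed.

Lemma lap_sub_exp x : M (x *+ e).
Proof. by exists x, 0; rewrite !iter_lap0 subr0 addr0. Qed.

(** As t^2 = w t - 1, [V] is generated over Z[w] by [s] and t [s]. Modulo [M], powers of w from b on
    reduce to lower ones, so the w^i x with x in [s2] and i < b generate a group of exponent
    dividing [e]. *)
Lemma lap_sub_finite (s : seq V) : (0 < e)%N -> (a < b)%N ->
  (forall H : V -> Prop, sub_closed H -> (forall x n, H x -> H (t n x)) ->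
     (forall x, x \in s -> H x) -> forall x, H x) ->
  exists l : seq V, forall x, exists2 y, y \in l & M (x - y).
Proof.
move=> e_gt0 ltab gen_s; have subM := lap_sub_closed.
pose s2 := s ++ map (t 1) s.
pose T := [seq iter i lap x | x <- s2, i <- iota 0 b].
have TP x i : x \in s2 -> (i < b)%N -> iter i lap x \in T.
  by move=> sx ltib; apply/allpairsP; exists (x, i); rewrite /= mem_iota.
have [l] := finite_mod_exponent T subM e_gt0 lap_sub_exp.
set H := fun x => exists2 y, y \in l & M (x - y); case=> subH HT MH minH.
exists l; apply: gen_s; rewrite -/H.
- exact: subH.
- have Hlap x : H x -> H (lap x).
    apply: (minH (fun x => H (lap x))).
    + split; first by rewrite raddf0; case: subH.
      by move=> y z Hy Hz; rewrite lapB; case: subH => _; apply.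
    + move=> _ /allpairsP[[y i] /= [sy + ->]].
      rewrite mem_iota /= add0n => ltib.
      have [ltSib|leSib] := ltnP i.+1 b.
        by rewrite -iterS; apply/HT/TP.
      (* Here i + 1 = b, and w^b y is congruent to w^a y modulo [M], with a < b. *)
      have -> : lap (iter i lap y) =
          (iter b lap y - iter a lap y) + iter a lap y.
        by rewrite subrK (_ : b = i.+1)//; lia.
      apply: sub_closedD => //; last exact/HT/TP.
      by apply: MH; exists 0, y; rewrite mul0rn add0r.
    + by move=> y My; apply/MH/(lap_sub_morph (g := lap)).
  have Hiter x i : x \in s2 -> H (iter i lap x).
    move=> sx; elim: i => [|i IHi]; last exact: Hlap.
    by apply/HT/(TP x 0%N) => //; lia.
  have Ht1 x : H x -> H (t 1 x).
    apply: (minH (fun x => H (t 1 x))).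
    + split; first by rewrite raddf0; case: subH.
      by move=> y z Hy Hz; rewrite raddfB; case: subH => _; apply.
    + move=> _ /allpairsP[[y i] /= [sy _ ->]].
      rewrite iter_lap_comm; last exact: t_lap.
      move: sy; rewrite mem_cat => /orP[sy|/mapP[z sz ->]].
        by apply: Hiter; rewrite mem_cat map_f ?orbT.
      have -> : t 1 (t 1 z) = lap (t 1 z) - z.
        by rewrite /lap -[t (-1) _]tD addNr t0 addrK.
      rewrite iter_lapB -iterSr; case: subH => _; apply; apply: Hiter.
        by rewrite mem_cat map_f ?orbT.
      by rewrite mem_cat sz.
    + by move=> y My; apply/MH/lap_sub_shift.
  have HtN1 x : H x -> H (t (-1) x).
    move=> Hx; have -> : t (-1) x = lap x - t 1 x by rewrite /lap addrC addKr.
    by case: subH => _; apply; [apply: Hlap | apply: Ht1].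
  move=> x n Hx; elim/int_rec: n => [|n IHn|n IHn]; first by rewrite t0.
    by rewrite -add1n PoszD tD; apply: Ht1.
  by rewrite -add1n PoszD opprD tD; apply: HtN1.
- by move=> x sx; apply/HT/(TP x 0%N); rewrite ?mem_cat ?sx //; lia.
Qed.

End LapSub.
End Shift.
End ShiftModule.

(** * Twisted conjugacy as an equivalence relation *)

Section TwistedConjugacy.
Local Open Scope group_scope.
Variables (G : groupType) (phi : {multiplicative G -> G}).

Lemma twisted_conj_refl x : twisted_conj phi x x.
Proof. by exists 1; rewrite invg1 multiplicative1 mul1g mulg1. Qed.

Lemma twisted_conj_sym x y : twisted_conj phi x y -> twisted_conj phi y x.
Proof.
case=> g ->; exists g^-1.
by rewrite invgK multiplicativeV !mulgA mulVg mul1g mulgVK.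
Qed.

Lemma twisted_conj_trans x y z :
  twisted_conj phi x y -> twisted_conj phi y z -> twisted_conj phi x z.
Proof.
by case=> g -> [h ->]; exists (h * g); rewrite invgM gmulfM !mulgA.
Qed.

Lemma twisted_class_eq x y :
  [set z | twisted_conj phi x z]%classic
    = [set z | twisted_conj phi y z]%classic <->
  twisted_conj phi x y.
Proof.
split=> [eq_xy | xy].
  have : [set z | twisted_conj phi y z]%classic y by apply: twisted_conj_refl.
  by rewrite -eq_xy.
apply/predeqP => z; split; apply: twisted_conj_trans => //.
exact: twisted_conj_sym.
Qed.

End TwistedConjugacy.

(** * The base group as a shift module, and coordinates on the wreath product *)

Section Wreath.
Local Open Scope ring_scope.
Variables (A : groupType) (hab : forall x y : A, commute x y).

Lemma dsum_mulC : commutative (@dsum_mul A).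
Proof. by move=> x y; apply/fsfunP => i; rewrite !dsum_mulE; apply: hab. Qed.

(** The direct sum in additive notation; its operations are convertible to those of [dsum A], so
    products in the wreath product can be computed additively. *)
Definition base : zmodType := HB.pack (dsum A)
  (GRing.isZmodule.Build (dsum A) (@dsum_mulA A) dsum_mulC (@dsum_mul1g A)
     (@dsum_mulVg A)).

Definition base_shift_fun (n : int) (x : base) : base := dsum_shift n x.

Lemma base_shift_is_additive n : zmod_morphism (base_shift_fun n).
Proof.
move=> x y; apply/fsfunP => i; rewrite /base_shift_fun.
by rewrite dsum_shiftE !(dsum_mulE, dsum_invE) !dsum_shiftE.
Qed.

HB.instance Definition _ n :=
  GRing.isZmodMorphism.Build base base (base_shift_fun n)
    (base_shift_is_additive n).

Definition base_shift (n : int) : {additive base -> base} := base_shift_fun n.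
Local Notation t := base_shift.

Lemma base_shift0 x : t 0 x = x. Proof. exact: dsum_shift0. Qed.

Lemma base_shiftD m n x : t (m + n) x = t m (t n x).
Proof. exact: dsum_shiftD. Qed.

Lemma base_shiftK n x : t (- n) (t n x) = x.
Proof. by rewrite -base_shiftD addNr base_shift0. Qed.

Lemma base_shiftNK n x : t n (t (- n) x) = x.
Proof. by rewrite -base_shiftD subrr base_shift0. Qed.

(** A fixed point is periodic in the index, while its support is finite. *)
Lemma base_shift_fix n x : n != 0 -> t n x = x -> x = 0.
Proof.
move=> n0 tx; apply/fsfunP => i; rewrite (dsum_oneE A i).
have per (k : nat) : (x : dsum A) i = (x : dsum A) (i + n *+ k).
  elim: k => [|k ->]; first by rewrite addr0.
  have := congr1 (fun y : dsum A => y (i + n *+ k.+1)) tx.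
  by rewrite /= dsum_shiftE mulrSr addrA addrK.
pose B := (\sum_(j <- finsupp (x : dsum A)) `|j|)%N.
have xB j : (B < `|j|)%N -> (x : dsum A) j = 1%g.
  move=> ltBj; case: finsuppP => // xj; move: ltBj.
  by rewrite /B (big_fsetD1 j) //= ltnNge leq_addr.
(* After that many steps of [n], of either sign, the index exceeds the bound [B] on the support. *)
by rewrite (per (`|i| + B + 1)%N); apply: xB; nia.
Qed.

Definition base_delta (a : A) : base :=
  [fsfun i in [fset 0 : int]%fset => a | 1%g].

Lemma base_deltaE a i : (base_delta a : dsum A) i = if i == 0 then a else 1%g.
Proof. by rewrite fsfunE inE. Qed.

(** Induction on a list containing the support: subtracting the shifted delta at [i] erases the
    entry at [i]. *)
Lemma base_generated (s : seq A) (H : base -> Prop) :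
  (forall H : set A, H 1%g -> (forall x y, H x -> H y -> H (x / y)%g) ->
    (forall x, x \in s -> H x) -> forall x, H x) ->
  sub_closed H -> (forall x n, H x -> H (t n x)) ->
  (forall x, x \in map base_delta s -> H x) -> forall x, H x.
Proof.
move=> gen_s subH Ht Hs; have [H0 HB] := subH.
have Hdelta a : H (base_delta a).
  move: a; apply: (gen_s (fun a => H (base_delta a))).
  - have -> // : base_delta 1%g = 0.
    by apply/fsfunP => i; rewrite base_deltaE (dsum_oneE A i) if_same.
  - move=> a b Ha Hb.
    have -> : base_delta (a / b)%g = base_delta a - base_delta b.
      apply/fsfunP => i; rewrite dsum_mulE dsum_invE !base_deltaE.
      by case: ifP => // _; rewrite mul1g invg1.
    exact: HB.
  - by move=> a sa; apply/Hs/map_f.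
suff Hsupp (u : seq int) (x : base) :
    {subset finsupp (x : dsum A) <= u} -> H x.
  by move=> x; apply: (Hsupp (finsupp (x : dsum A))).
elim: u x => [|i u IHu] x xu.
  suff -> : x = 0 by [].
  apply/fsfunP => j; rewrite (dsum_oneE A j).
  by case: finsuppP => // /xu.
rewrite -(subrK (t i (base_delta ((x : dsum A) i))) x).
apply: sub_closedD => //; last exact: Ht.
apply: IHu => j; rewrite mem_finsupp dsum_mulE dsum_invE dsum_shiftE.
rewrite base_deltaE subr_eq0; have [->|ne_ji] := eqVneq j i.
  by rewrite mulgV eqxx.
rewrite invg1 mulg1 -mem_finsupp => /xu.
by rewrite inE (negbTE ne_ji).
Qed.

(* Locked, so that unification does not see an arbitrary product as a pair. *)
Definition wr (x : base) (n : int) : wreathZ A := locked (x, n).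

Lemma wr_snd x n : (wr x n).2 = n. Proof. by rewrite /wr -lock. Qed.

Lemma wr_eta (g : wreathZ A) : g = wr g.1 g.2.
Proof. by rewrite /wr -lock; case: g. Qed.

Lemma wrP g : exists x n, g = wr x n.
Proof. by exists g.1, g.2; apply: wr_eta. Qed.

Lemma wr1 : 1%g = wr 0 0. Proof. by rewrite /wr -lock. Qed.

Lemma wrM x m y n : (wr x m * wr y n)%g = wr (x + t m y) (m + n).
Proof. by rewrite /wr -!lock. Qed.

Lemma wrV x n : (wr x n)^-1%g = wr (- t (- n) x) (- n).
Proof. by rewrite -raddfN /wr -!lock. Qed.

Lemma wr_inj x y m n : wr x m = wr y n -> x = y /\ m = n.
Proof. by rewrite /wr -!lock => -[]. Qed.

Lemma wrM_snd (g h : wreathZ A) : (g * h)%g.2 = g.2 + h.2. Proof. by []. Qed.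

(** * The automorphism on the base group and on the quotient Z *)

Section Automorphism.
Variables (phi : {multiplicative (wreathZ A) -> (wreathZ A)}).
Hypotheses (bij_phi : bijective phi)
           (fin_phi : finite_set (reidemeister_classes phi)).

(* For n <> 0, (x, n) fails to commute with its conjugates by the base group
   unless the latter is trivial; hence the base group is characteristic. *)
Lemma phi_base x : (phi (wr x 0)).2 = 0.
Proof.
have [psi phiK psiK] := bij_phi.
have [y [n phix]] := wrP (phi (wr x 0)); rewrite phix wr_snd.
have [//|n0] := eqVneq n 0.
have comm g : commute (wr x 0) (g * wr x 0 * g^-1)%g.
  have [z [k ->]] := wrP g; rewrite /commute wrV !wrM.
  by rewrite !(add0r, addr0) subrr !base_shift0 addrC.
have comm_phi h : commute (phi (wr x 0)) (h * phi (wr x 0) * h^-1)%g.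
  have := comm (psi h) => /(gmulf_commute phi).
  by rewrite !gmulfM multiplicativeV psiK.
(* Commutation of (y, n) with its conjugate by [h] reads (1 - t^n)^2 h = 0. *)
have base0 (h : base) : h = 0.
  have := comm_phi (wr h 0); rewrite phix /commute wrV !wrM oppr0 !base_shift0.
  rewrite !(add0r, addr0) => /wr_inj[+ _].
  rewrite !raddfD !raddfN => eq_h.
  apply/(base_shift_fix n0)/esym/subr0_eq/(base_shift_fix n0).
  apply: (addIr (y + t n y)); rewrite raddfB addrCA [_ - _ + t n y]addrAC eq_h.
  by rewrite [RHS]addrA [h - _ + y]addrAC.
have := phix; rewrite [x]base0 -wr1 multiplicative1 wr1 => /wr_inj[_ n00].
by rewrite -n00.
Qed.

(** The map f of the header. *)
Definition phi_lin (x : base) : base := (phi (wr x 0)).1.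

Lemma phi_wr0 x : phi (wr x 0) = wr (phi_lin x) 0.
Proof. by rewrite [LHS]wr_eta phi_base. Qed.

Lemma phi_lin_is_additive : zmod_morphism phi_lin.
Proof.
move=> x y; apply/eqP; rewrite -(inj_eq (addIr (phi_lin y))) subrK; apply/eqP.
have Ex : wr x 0 = (wr (x - y) 0 * wr y 0)%g.
  by rewrite wrM base_shift0 subrK addr0.
have := phi_wr0 x; rewrite Ex gmulfM !phi_wr0 wrM base_shift0.
by case/wr_inj.
Qed.

HB.instance Definition _ :=
  GRing.isZmodMorphism.Build base base phi_lin phi_lin_is_additive.

Lemma phi_lin0 : phi_lin 0 = 0. Proof. exact: raddf0. Qed.

Lemma phi_linN x : phi_lin (- x) = - phi_lin x. Proof. exact: raddfN. Qed.

Lemma phi_linD x y : phi_lin (x + y) = phi_lin x + phi_lin y.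
Proof. exact: raddfD. Qed.

Lemma phi_linB x y : phi_lin (x - y) = phi_lin x - phi_lin y.
Proof. exact: raddfB. Qed.

(* phi (x, n) = (phi_lin x + phi_tr n, - n), see phi_wr. *)
Definition phi_tr (n : int) : base := (phi (wr 0 n)).1.

(* If phi induced the identity of Z, the second coordinate would be an invariant
   of twisted conjugacy with infinitely many values. *)
Lemma phi_int n : (phi (wr 0 n)).2 = - n.
Proof.
have phiD (m k : int) :
    (phi (wr 0 (m + k))).2 = (phi (wr 0 m)).2 + (phi (wr 0 k)).2.
  have -> : wr 0 (m + k) = (wr 0 m * wr 0 k)%g by rewrite wrM raddf0 addr0.
  by rewrite gmulfM wrM_snd.
have phi0 : (phi (wr 0 0)).2 = 0 by rewrite -wr1 multiplicative1 wr1 wr_snd.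
have phiN k : (phi (wr 0 (- k))).2 = - (phi (wr 0 k)).2.
  by apply/eqP; rewrite -addr_eq0 -phiD addNr phi0.
have phiE k : (phi (wr 0 k)).2 = k * (phi (wr 0 1)).2.
  elim/int_rec: k => [|k IHk|k IHk]; first by rewrite mul0r.
    by rewrite -add1n PoszD phiD IHk mulrDl mul1r.
  by rewrite -add1n PoszD opprD phiD IHk phiN mulrDl mulN1r.
have phi2 x k : (phi (wr x k)).2 = (phi (wr 0 k)).2.
  have -> : wr x k = (wr x 0 * wr 0 k)%g by rewrite wrM raddf0 addr0 add0r.
  by rewrite gmulfM wrM_snd phi_wr0 wr_snd add0r.
have [psi phiK psiK] := bij_phi.
(* Surjectivity of [phi] makes 1 a multiple of this integer. *)
have c1 : (phi (wr 0 1)).2 = 1 \/ (phi (wr 0 1)).2 = -1.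
  have := congr1 snd (psiK (wr 0 1)); have [x [k ->]] := wrP (psi (wr 0 1)).
  rewrite phi2 phiE !wr_snd => /(congr1 absz)/eqP.
  by rewrite abszM muln_eq1; lia.
rewrite phiE; case: c1 => c1; rewrite c1; last by rewrite mulrN1.
have /finite_seqP[L LE] := fin_phi.
pose h (k : nat) := [set z | twisted_conj phi (wr 0 k) z]%classic.
have hL k : h k \in L.
  by have : reidemeister_classes phi (h k) by [exists (wr 0 k)]; rewrite LE.
have h_inj i j : h i = h j -> i = j.
  move/twisted_class_eq => [g /(congr1 snd)].
  have phi_g : (phi g^-1%g).2 = (g^-1)%g.2.
    by rewrite [g^-1%g]wr_eta phi2 phiE c1 mulr1 wr_snd.
  by rewrite !wrM_snd phi_g {1 2}[g]wr_eta wrV !wr_snd; lia.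
(* An injective [h] meets the shift condition of [pigeonhole_period], which then contradicts
   injectivity. *)
have /h_inj : h (size L + (size L)`!)%N = h (size L).
  by apply: pigeonhole_period => // i j k /h_inj->.
by have := fact_gt0 (size L); lia.
Qed.

Lemma phi_wr x n : phi (wr x n) = wr (phi_lin x + phi_tr n) (- n).
Proof.
have -> : wr x n = (wr x 0 * wr 0 n)%g by rewrite wrM raddf0 addr0 add0r.
rewrite gmulfM phi_wr0 -phi_int /phi_tr.
by rewrite {1}[phi (wr 0 n)]wr_eta wrM base_shift0 add0r.
Qed.

(** The shift is conjugation by (0, n), and [phi] negates n. *)
Lemma phi_lin_shift n x : phi_lin (t n x) = t (- n) (phi_lin x).
Proof.
have : phi (wr 0 n * wr x 0)%g = phi (wr (t n x) 0 * wr 0 n)%g.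
  by rewrite !wrM add0r addr0 raddf0 addr0 add0r.
rewrite !gmulfM !phi_wr0 !phi_wr phi_lin0 !add0r !wrM base_shift0.
by rewrite [_ + phi_tr n]addrC => /wr_inj[/addrI].
Qed.

(** [phi_tr] is a crossed homomorphism for the inverse shift action. *)
Lemma phi_trD m n : phi_tr (m + n) = phi_tr m + t (- m) (phi_tr n).
Proof.
have : phi (wr 0 (m + n)) = phi (wr 0 m * wr 0 n)%g.
  by rewrite wrM raddf0 addr0.
by rewrite gmulfM !phi_wr phi_lin0 !add0r wrM => /wr_inj[].
Qed.

Lemma phi_tr0 : phi_tr 0 = 0.
Proof. by rewrite /phi_tr -wr1 multiplicative1. Qed.

Lemma phi_trN n : phi_tr (- n) = - t n (phi_tr n).
Proof.
by apply/eqP; rewrite -addr_eq0 -[n in t n]opprK -phi_trD addNr phi_tr0.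
Qed.

(** * Twisted classes inside a coset of the base group *)

Lemma twisted_conj_wr x n g : twisted_conj phi (wr x n) g <->
  exists h m,
    g = wr (h + t m x - t (m + n + m) (phi_lin h) + t (m + n) (phi_tr (- m)))
           (m + n + m).
Proof.
have E h m : (wr h m * wr x n * phi (wr h m)^-1)%g =
    wr (h + t m x - t (m + n + m) (phi_lin h) + t (m + n) (phi_tr (- m)))
       (m + n + m).
  rewrite wrV phi_wr !wrM opprK phi_linN phi_lin_shift opprK raddfD raddfN.
  by rewrite -base_shiftD addrA.
split=> [[g' ->]|[h [m ->]]].
  by have [h [m ->]] := wrP g'; exists h, m; rewrite E.
by exists (wr h m); rewrite E.
Qed.

(** The subgroup D_n of the header. *)
Definition twist_image (n : int) (z : base) :=
  exists h, z = h - t n (phi_lin h).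

Lemma twist_image_sub n : sub_closed (twist_image n).
Proof.
split; first by exists 0; rewrite phi_lin0 raddf0 subr0.
move=> _ _ [h ->] [h' ->]; exists (h - h').
rewrite phi_linB [t n (_ - _)]raddfB !opprB addrACA [RHS]addrACA.
by rewrite [- h' - _]addrC.
Qed.

(** Twisted conjugation by (h, m) moves the second coordinate by 2m, so staying in the coset forces
    m = 0. *)
Lemma twisted_conj_base n x y :
  twisted_conj phi (wr x n) (wr y n) <-> twist_image n (y - x).
Proof.
rewrite twisted_conj_wr; split=> [[h [m /wr_inj[eq_y eq_m]]]|[h eq_yx]].
  have m0 : m = 0 by lia.
  exists h; rewrite eq_y m0 base_shift0 !(add0r, addr0) oppr0 phi_tr0.
  by rewrite raddf0 addr0 addrAC addrK.
exists h, 0; rewrite base_shift0 !(add0r, addr0) oppr0 phi_tr0 raddf0 addr0.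
by rewrite addrAC -eq_yx subrK.
Qed.

(** Distinct cosets of D_n give distinct twisted classes, so one bound r serves for all n. *)
Lemma twist_image_period : exists r : nat, forall n (c : nat -> base),
  (forall i j k, twist_image n (c j - c i) ->
                 twist_image n (c (j + k)%N - c (i + k)%N)) ->
  twist_image n (c (r + r`!)%N - c r).
Proof.
have /finite_seqP[L LE] := fin_phi; exists (size L) => n c cshift.
pose h k := [set z | twisted_conj phi (wr (c k) n) z]%classic.
have hP i j : h i = h j <-> twist_image n (c j - c i).
  by rewrite twisted_class_eq twisted_conj_base.
apply/hP/esym/pigeonhole_period => [k|i j k /hP Dij]; last exact/hP/cshift.
by have : reidemeister_classes phi (h k) by [exists (wr (c k) n)]; rewrite LE.
Qed.

Local Notation lap := (lap base_shift).

Lemma phi_lin_lap x : phi_lin (lap x) = lap (phi_lin x).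
Proof. by rewrite phi_linD !phi_lin_shift addrC. Qed.

Lemma phi_lin_iter_lap k x : phi_lin (iter k lap x) = iter k lap (phi_lin x).
Proof. exact: (iter_lap_comm (g := phi_lin) _ _ phi_lin_lap). Qed.

(** The sequences k x and w^k x are periodic modulo D_n, which is stable under w; this puts r! x and
    (w^(r + r!) - w^r) x in D_n. *)
Lemma lap_sub_twist_image : exists r, forall n x,
  lap_sub base_shift r`! r (r + r`!) x -> twist_image n x.
Proof.
have [r per] := twist_image_period; exists r => n.
apply: lap_sub_min; first exact: twist_image_sub.
- move=> x; have := per n (fun k => x *+ k).
  rewrite mulrnDr addrAC subrr add0r; apply=> i j k.
  by rewrite !mulrnDr opprD addrACA subrr addr0.
- move=> x; apply: (per n (fun k => iter k lap x)) => i j k [h eq_h].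
  rewrite addnC [(i + k)%N]addnC !iterD -iter_lapB eq_h; exists (iter k lap h).
  rewrite iter_lapB; congr (_ - _); rewrite phi_lin_iter_lap.
  by apply/esym/iter_lap_comm => y; apply: (t_lap base_shiftD).
Qed.

(** * The normal subgroup of finite index built from M *)

Section FiniteIndex.
Variables (e a b : nat) (l : seq base).
Local Notation M := (lap_sub base_shift e a b).
Hypotheses (e_gt0 : (0 < e)%N)
           (Ml : forall x, exists2 y, y \in l & M (x - y))
           (M_twist : forall n x, M x -> twist_image n x).

Let subM : sub_closed M := lap_sub_closed base_shift e a b.

Lemma lap_sub_base_shift n x : M x -> M (t n x).
Proof. exact: (lap_sub_shift base_shiftD). Qed.

Definition acts_trivially (k : int) := forall x, M (t k x - x).

Lemma acts_trivially_sub : sub_closed acts_trivially.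
Proof.
have [M0 MB] := subM.
split=> [x|m n Mm Mn x]; first by rewrite base_shift0 subrr.
rewrite base_shiftD -[x in _ - x](base_shiftNK n).
have -> : t m (t (- n) x) - t n (t (- n) x) =
          (t m (t (- n) x) - t (- n) x) - (t n (t (- n) x) - t (- n) x).
  by rewrite opprB addrA subrK.
exact: MB.
Qed.

(** The subgroup of Z announced in the header; the second condition puts the [phi_tr] term of
    [twisted_conj_wr] in [M]. *)
Definition trivial_mod (k : int) := acts_trivially k /\ M (phi_tr k).

Lemma trivial_mod_sub : sub_closed trivial_mod.
Proof.
have [M0 MB] := subM; have [t0 tB] := acts_trivially_sub.
split; first by rewrite /trivial_mod phi_tr0.
move=> m n [Mm am] [Mn an]; split; first exact: tB.
rewrite phi_trD phi_trN raddfN; apply: MB => //.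
by do 2!apply: lap_sub_base_shift.
Qed.

(** By pigeonhole on the cosets of [M], t^q is trivial modulo [M]. On multiples of [q], [phi_tr] is
    then additive modulo [M], and the factor [e] kills it. *)
Lemma trivial_mod_pos : exists p : nat, (0 < p)%N /\ trivial_mod p.
Proof.
have [M0 MB] := subM.
pose coset y := [set z : base | M (z - y)]%classic.
have cosetP x y : coset x = coset y <-> M (x - y).
  split=> [eq_xy|Mxy].
    have : coset x x by rewrite /coset /= subrr.
    by rewrite eq_xy.
  apply/predeqP => z; split=> Mz.
    by have := sub_closedD subM Mz Mxy; rewrite addrA subrK.
  by have := MB _ _ Mz Mxy; rewrite opprB addrA subrK.
pose L := [seq coset y | y <- l].
pose q := (size L)`!%N.
have Mq x : M (t q%:Z x - x).
  pose h (k : nat) := coset (t k%:Z x).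
  have hL k : h k \in L.
    have [y ly My] := Ml (t k%:Z x); apply/mapP; exists y => //.
    exact/cosetP.
  have /cosetP : h (size L + q)%N = h (size L).
    apply: pigeonhole_period => // m n j /cosetP Mmn; apply/cosetP.
    rewrite !PoszD ![_ + j%:Z]addrC !base_shiftD -raddfB.
    exact: lap_sub_base_shift.
  rewrite PoszD base_shiftD -raddfB => /(lap_sub_base_shift (- (size L)%:Z)).
  by rewrite base_shiftK.
have qX (j : nat) : acts_trivially (q%:Z *+ j).
  exact: (sub_closedMn acts_trivially_sub _ Mq).
have aX (j : nat) : M (phi_tr (q%:Z *+ j) - phi_tr q%:Z *+ j).
  elim: j => [|j IHj]; first by rewrite !mulr0n phi_tr0 subrr.
  rewrite !mulrSr phi_trD opprD addrACA; apply: sub_closedD => //.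
  by have := sub_closedN acts_trivially_sub (qX j); apply.
exists (q * e)%N; split; first by rewrite muln_gt0 fact_gt0.
have -> : (q * e)%N%:Z = q%:Z *+ e by rewrite PoszM -mulr_natr natz.
split=> //; rewrite -(subrK (phi_tr q%:Z *+ e) (phi_tr _)).
by apply: sub_closedD => //; apply: lap_sub_exp.
Qed.

(** The doubling [k + k] matches the move of the second coordinate under twisted conjugation by an
    element over [k]. *)
Definition wr_sub (g : wreathZ A) :=
  exists (x : base) (k : int), [/\ g = wr x (k + k), M x & trivial_mod k].

Lemma twisted_class_wr_sub x g h :
  twisted_conj phi x g -> wr_sub h -> twisted_conj phi x (g * h)%g.
Proof.
move=> xg [y [k [-> My [tk ak]]]]; apply: (twisted_conj_trans xg).
have [z [n ->]] := wrP g; rewrite wrM; apply/twisted_conj_wr.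
have [_ MB] := subM.
(* This is the difference of first coordinates left to the choice of [h'] when conjugating by
   [wr h' k]. *)
have /M_twist : M (z + t n y - t k z - t (k + n) (phi_tr (- k))).
  have [_ aNk] := sub_closedN trivial_mod_sub (conj tk ak).
  apply: (MB); last exact: lap_sub_base_shift.
  rewrite [z + _]addrC -addrA -opprB; apply: (MB).
    exact: lap_sub_base_shift.
  exact: tk.
move=> /(_ (k + n + k))[h' eq_h]; exists h', k; congr wr; last by lia.
by rewrite [h' + _ - _]addrAC -eq_h addrAC !subrK.
Qed.

Lemma twisted_class_separable (C : set (wreathZ A)) :
  reidemeister_classes phi C ->
  exists (K : finGroupType) (phiK : {multiplicative K -> K})
         (F : {multiplicative (wreathZ A) -> K}) (S : set K),
    [/\ bijective phiK,
        (forall k : K, exists x, F x = k),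
        F \o phi =1 phiK \o F
      & char_fun C =1 char_fun S \o F].
Proof.
case=> x ->; have [M0 MB] := subM; have [P0 PB] := trivial_mod_sub.
have [p [p_gt0 Pp]] := trivial_mod_pos.
pose l' := [seq wr y j%:Z | y <- l, j <- iota 0 (p + p)].
apply: (RP_of_normal (N := wr_sub) (l := l')) => //.
- by exists 0, 0; split; rewrite // wr1.
- move=> _ _ [y [k [-> My Pk]]] [z [j [-> Mz Pj]]].
  exists (t (- (k + k)) (z - y)), (j - k); split; last exact: PB.
    rewrite wrV wrM [t _ (z - y)]raddfB [- _ + t _ z]addrC.
    by congr wr; lia.
  by apply/lap_sub_base_shift/MB.
- move=> _ g [y [k [-> My Pk]]]; have [z [n ->]] := wrP g.
  (* Conjugation adds t^(2k) z - z, which is in [M] because t^(2k) is trivial modulo [M]. *)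
  exists (t (- n) (y + (t (k + k) z - z))), k; split=> //.
    rewrite wrV !wrM; congr wr; last by lia.
    rewrite [t (- n + _) z]base_shiftD !raddfD raddfN.
    by rewrite -[LHS]addrA [LHS]addrC addrA.
  have [Pkk _] := sub_closedD trivial_mod_sub Pk Pk.
  by apply/lap_sub_base_shift/(sub_closedD subM My)/Pkk.
- move=> g; have [z [n ->]] := wrP g; have [y ly Mzy] := Ml z.
  have pp_gt0 : (0 < (p + p)%N%:Z)%R by lia.
  have pp_neq0 : (p + p)%N%:Z != 0 by lia.
  have modn_ge0 := modz_ge0 n pp_neq0; have := ltz_pmod n pp_gt0.
  case def_j: (n %% (p + p)%N)%Z modn_ge0 => [j|//] _ ltj.
  exists (wr y j); first by apply/allpairsP; exists (y, j); rewrite /= mem_iota.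
  (* Division of [n] by 2p with remainder [j]: n - j is twice a multiple of [p]. *)
  exists (t (- j%:Z) (z - y)), (p%:Z * (n %/ (p + p)%N)%Z); split.
  + rewrite wrV wrM [t _ (z - y)]raddfB [- _ + t _ z]addrC; congr wr.
    by have := divz_eq n (p + p)%N; rewrite def_j; nia.
  + exact: lap_sub_base_shift.
  + have PX (m : nat) : trivial_mod (p%:Z * m%:Z).
      rewrite -[m%:Z]natz mulr_natr.
      exact: (sub_closedMn trivial_mod_sub _ Pp).
    case: (n %/ _)%Z => m; first exact: PX.
    by rewrite NegzE mulrN; apply: (sub_closedN trivial_mod_sub (PX _)).
- move=> _ [y [k [-> My Pk]]]; exists (phi_lin y + phi_tr (k + k)), (- k).
  rewrite phi_wr opprD; split=> //; last by apply: sub_closedN.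
  have [_ Mkk] := sub_closedD trivial_mod_sub Pk Pk.
  apply: (sub_closedD subM) => //.
  exact: (lap_sub_morph (g := phi_lin)) phi_lin_lap _.
- move=> g h /=; exact: twisted_class_wr_sub.
Qed.

End FiniteIndex.
End Automorphism.
End Wreath.

Theorem theorem1 (A : groupType) (hab : forall x y : A, commute x y)
  (hfg : finitely_generated A) : RP_property (wreathZ A).
Proof.
move=> phi bij_phi fin_phi C CR; have [s gen_s] := hfg.
have [r Mtwist] := lap_sub_twist_image hab bij_phi fin_phi.
have lt_r : (r < r + r`!)%N by rewrite -[ltnLHS]addn0 ltn_add2l fact_gt0.
(* Finite generation of [A] enters here, through the deltas of its generators. *)
have [l Ml] := lap_sub_finite (@base_shift0 A hab) (@base_shiftD A hab)
  (fact_gt0 r) lt_r (fun H => base_generated (hab := hab) gen_s).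
exact: (twisted_class_separable bij_phi fin_phi (fact_gt0 r) Ml Mtwist CR).
Qed.
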